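(* Let $q\ge 3$ be a prime power and let $t\in\mathbb{F}_q\setminus\{2,-2\}$. Then we may write $t=\omega+\omega^{-1}$ for some $\omega\in\mathbb{F}_{q^2}^\times\setminus\{-1,1\}$, and the set $\{\omega,\omega^{-1}\}$ is uniquely determined by $t$. Let $P=(A,B,C)$ be an $\mathbb{F}_q$-point of the hypersurface defined by $$x^2+y^2+z^2-xyz=t+2,$$ and let $\Gamma$ act on the $\mathbb{F}_q$-points of this hypersurface. Suppose at least two of $A,B,C$ are nonzero. Let $\ell$ be an odd prime, let $r:=\mathrm{ord}_\ell(|\omega|)$, and write $\mathrm{ord}_\ell(|\mathrm{SL}_2(\mathbb{F}_q)|)=\mathrm{ord}_\ell(q^3-q)=r+s$. Then the $\Gamma$-orbit of $P$ has cardinality $$\equiv 0\mod \ell^{\max\{r-s,0\}}.$$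
   Context: $\Gamma$ is the group of polynomial automorphisms of $\mathbb{A}^3$ generated by permutations of the coordinates and the Vieta involution $(x,y,z)\mapsto(x,y,xy-z)$; it preserves each hypersurface $x^2+y^2+z^2-xyz=t+2$. $|\omega|$ denotes the multiplicative order of $\omega$. *)

(* Defs.v *)
From HB Require Import structures.
From mathcomp Require Import all_boot all_fingroup all_order all_algebra.
From mathcomp Require Import boolp.
From mathcomp Require Import mpoly.
From mathcomp Require Import ring.

Set Implicit Arguments.
Unset Strict Implicit.
Unset Printing Implicit Defensive.

Import GRing.Theory.
Local Open Scope ring_scope.

(* A polynomial self-map of affine 3-space over the integers, given by its
   three coordinate polynomials. *)
Definition polymap := 3.-tuple {mpoly int[3]}.

Definition pm_id : polymap := [tuple 'X_i | i < 3].

(* The composite "f after g". *)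
Definition pm_comp (f g : polymap) : polymap :=
  [tuple (tnth f i) \mPo g | i < 3].

Definition pm_perm (s : 'S_3) : polymap := [tuple 'X_(s i) | i < 3].

Definition pm_vieta : polymap :=
  [tuple 'X_(inord 0); 'X_(inord 1);
         'X_(inord 0) * 'X_(inord 1) - 'X_(inord 2)].

(* Membership in the group generated by the coordinate permutations and the
   Vieta involution, inside the group of invertible polynomial self-maps. *)
Inductive Gamma : polymap -> Prop :=
| Gamma_id : Gamma pm_id
| Gamma_perm (s : 'S_3) : Gamma (pm_perm s)
| Gamma_vieta : Gamma pm_vieta
| Gamma_comp f g : Gamma f -> Gamma g -> Gamma (pm_comp f g)
| Gamma_inv f g :
    Gamma f -> pm_comp f g = pm_id -> pm_comp g f = pm_id -> Gamma g.

(* The value of a polynomial self-map at an R-point: [mmap intr] evaluates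
   integer polynomials in R. *)
Definition pm_act (R : comNzRingType) (f : polymap) (P : 3.-tuple R) :
  3.-tuple R := [tuple mmap intr (tnth P) (tnth f i) | i < 3].

Definition on_surface (R : comNzRingType) (t : R) (P : 3.-tuple R) : bool :=
  let x := tnth P (inord 0) in
  let y := tnth P (inord 1) in
  let z := tnth P (inord 2) in
  x ^+ 2 + y ^+ 2 + z ^+ 2 - x * y * z == t + 2.

(* By [Gamma_on_surface] below, the orbit of a point of a surface
   [on_surface t] stays inside that surface. *)
Definition Gamma_orbit (F : finFieldType) (P : 3.-tuple F) :
  {set 3.-tuple F} :=
  [set Q | `[< exists2 f, Gamma f & Q = pm_act f P >]].

Definition SL2 (F : finFieldType) : {set 'M[F]_2} := [set M | \det M == 1].

(* [iota] embeds F in its extension L, where the parameter w lives. *)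
Definition is_parameter (F L : finFieldType) (iota : {rmorphism F -> L})
    (t : F) (w : {unit L}) : Prop :=
  [/\ val w != 1, val w != -1 & iota t = val w + (val w)^-1].

Lemma pm_act_id (R : comNzRingType) (P : 3.-tuple R) : pm_act pm_id P = P.
Proof.
apply: eq_from_tnth => i.
by rewrite !tnth_mktuple mmapX mmap1U.
Qed.

Lemma pm_act_comp (R : comNzRingType) (f g : polymap) (P : 3.-tuple R) :
  pm_act (pm_comp f g) P = pm_act f (pm_act g P).
Proof.
apply: eq_from_tnth => i; rewrite !tnth_mktuple comp_mpolyE.
rewrite raddf_sum /= [RHS]/mmap; apply: eq_bigr => m _.
rewrite mmapZ; congr (_ * _).
rewrite rmorph_prod /= /mmap1; apply: eq_bigr => j _.
by rewrite rmorphXn /= tnth_mktuple.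
Qed.

Lemma Gamma_on_surface (R : comNzRingType) (t : R) (f : polymap)
    (P : 3.-tuple R) :
  Gamma f -> on_surface t (pm_act f P) = on_surface t P.
Proof.
move=> Gf; elim: Gf P => {f}.
- by move=> P; rewrite pm_act_id.
- move=> s P; rewrite /on_surface !tnth_mktuple !mmapX !mmap1U.
  have sum3 (G : 'I_3 -> R) :
      G (inord 0) + G (inord 1) + G (inord 2) = \sum_i G i.
    rewrite !big_ord_recl big_ord0 addr0 addrA.
    by do !congr (_ + _); congr G; apply: val_inj; rewrite /= ?inordK.
  have prod3 (G : 'I_3 -> R) :
      G (inord 0) * G (inord 1) * G (inord 2) = \prod_i G i.
    rewrite !big_ord_recl big_ord0 mulr1 mulrA.
    by do !congr (_ * _); congr G; apply: val_inj; rewrite /= ?inordK.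
  rewrite (sum3 (fun i => tnth P (s i) ^+ 2)) (prod3 (fun i => tnth P (s i))).
  rewrite (sum3 (fun i => tnth P i ^+ 2)) (prod3 (tnth P)).
  congr (_ - _ == _).
    by rewrite [RHS](reindex_inj (@perm_inj _ s)).
  by rewrite [RHS](reindex_inj (@perm_inj _ s)).
- move=> P; rewrite /on_surface !tnth_mktuple.
  rewrite !(tnth_nth 0) /= !inordK //= rmorphB rmorphM /= !mmapX !mmap1U.
  rewrite !(tnth_nth 0) /= !inordK //=.
  by congr (_ == _); ring.
- by move=> f g _ IHf _ IHg P; rewrite pm_act_comp IHf IHg.
- by move=> f g _ IHf fg _ P; rewrite -[RHS](congr1 _ (pm_act_id P)) -fg
    pm_act_comp IHf.
Qed.

(* Main.v *)
Require Import Defs.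
From mathcomp Require Import all_boot all_order all_algebra all_fingroup.
From mathcomp Require Import pgroup abelian cyclic.
From mathcomp Require Import fieldext galois finfield.
From mathcomp Require Import boolp mpoly ring zify.

(** Write tau = t + 2 and T_w(x, y, z) = xy - (1 + w) z. On the surface
    T_w T_{w^-1} = (x^2 - tau)(y^2 - tau), so the generic value of
    h(x, y, z) = (x^2 - tau) / T_w(x, y, z) can be continued to a nonzero value
    at every point with at most one zero coordinate. It satisfies
      h(x, y, z) h(y, z, x) h(z, x, y) = - 1/w,
      h(x, y, z) h(y, x, xy - z) = - 1/w.
    Let H be the product of h over an orbit of N points. The orbit is stable
    under both substitutions, hence H^3 = H^2 = (- 1/w)^N, so H = 1 and
    w^(2N) = 1. Thus |w| divides 2N, and the odd part of |w| divides N.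

    In matrix terms, (x, y, z) are the traces of a, b, ab with [a, b] of
    eigenvalues w and w^-1; h compares two normalisations of the pair (a, b)
    under the torus centralising [a, b], in the spirit of a transfer map for
    the braid group B_3, whose central element acts as conjugation by [a, b]. *)

Import GRing.Theory.
Local Open Scope ring_scope.

(** * Twists and their relations on the surface *)

Definition twist {K : fieldType} (w x y z : K) : K := x * y - (1 + w) * z.

(** Replacing a vanishing factor x^2 - tau by 1 keeps the continued h nonzero. *)
Definition nonzero_part {K : fieldType} (x : K) : K := if x == 0 then 1 else x.

Definition markoff {K : fieldType} (w x y z : K) : Prop :=
  x ^+ 2 + y ^+ 2 + z ^+ 2 - x * y * z = w + w^-1 + 2.

(** The two sides differ by a multiple of the surface equation. This links consecutive rotations in
    [cocycle_rot]. *)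
Lemma twist_mul {K : fieldType} {w x y z : K} :
  w != 0 -> markoff w x y z ->
  twist w x y z * twist w y z x
    = - w * (y ^+ 2 - (w + w^-1 + 2)) * twist w^-1 z x y.
Proof.
move=> w0 E; apply/eqP; rewrite -subr_eq0; apply/eqP.
transitivity (- (1 + w) * y *
    (x ^+ 2 + y ^+ 2 + z ^+ 2 - x * y * z - (w + w^-1 + 2))).
  by rewrite /twist; field.
by rewrite E subrr mulr0.
Qed.

(** Since [1 + w] and [1 + w^-1] have both sum and product tau, the two sides differ by tau times
    the surface equation. *)
Lemma twist_norm {K : fieldType} {w x y z : K} :
  w != 0 -> markoff w x y z ->
  twist w x y z * twist w^-1 x y z
    = (x ^+ 2 - (w + w^-1 + 2)) * (y ^+ 2 - (w + w^-1 + 2)).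
Proof.
move=> w0 E; apply/eqP; rewrite -subr_eq0; apply/eqP.
transitivity ((w + w^-1 + 2) *
    (x ^+ 2 + y ^+ 2 + z ^+ 2 - x * y * z - (w + w^-1 + 2))).
  by rewrite /twist; field.
by rewrite E subrr mulr0.
Qed.

Lemma twist_vieta {K : fieldType} {w x y z : K} :
  w != 0 -> twist w y x (x * y - z) = - w * twist w^-1 x y z.
Proof. by move=> w0; rewrite /twist; field. Qed.

(* By twist_norm both branches give (x^2 - tau) / T_w wherever neither T_w nor
   T_{w^-1} vanishes. *)
Definition cocycle {K : fieldType} (w x y z : K) : K :=
  if twist w x y z == 0
  then twist w^-1 x y z / nonzero_part (y ^+ 2 - (w + w^-1 + 2))
  else nonzero_part (x ^+ 2 - (w + w^-1 + 2)) / twist w x y z.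

Lemma nonzero_part_neq0 {K : fieldType} (x : K) : nonzero_part x != 0.
Proof. by rewrite /nonzero_part; case: ifP => [_|/negbT //]; exact: oner_neq0. Qed.

Lemma nonzero_partE {K : fieldType} (x : K) : x != 0 -> nonzero_part x = x.
Proof. by rewrite /nonzero_part => /negPf->. Qed.

(** * The two product formulas for the cocycle *)

(** As [v] is nonzero, so is [Y], and [nonzero_part Y] is [Y]. This and [nonzero_part_prodr] serve
    the degenerate cases of [cocycle_rot]. *)
Lemma nonzero_part_prodl {K : fieldType} {w Y u v : K} :
  w != 0 -> v != 0 -> v = - w * Y * u -> nonzero_part Y * u / v = - w^-1.
Proof.
move=> w0 v0 E; rewrite E !mulf_eq0 !negb_or -andbA in v0.
case/and3P: v0 => Nw0 Y0 u0; rewrite nonzero_partE // E.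
by field; rewrite w0 u0 Y0 Nw0.
Qed.

Lemma nonzero_part_prodr {K : fieldType} {w Y u v : K} :
  w != 0 -> v != 0 -> v = - w^-1 * Y * u -> v / (nonzero_part Y * u) = - w^-1.
Proof.
move=> w0 v0 E; rewrite E !mulf_eq0 !negb_or -andbA in v0.
case/and3P: v0 => _ Y0 u0; rewrite nonzero_partE // E.
by field; rewrite w0 u0 Y0.
Qed.

Definition two_zeros {K : fieldType} (x y z : K) : bool :=
  [|| (x == 0) && (y == 0), (y == 0) && (z == 0) | (z == 0) && (x == 0)].

(** The two twists differ by (w - 1/w) z, so if both vanish then z = 0, hence xy = 0. *)
Lemma twist_neq0 {K : fieldType} {w x y z : K} :
  w != 0 -> w ^+ 2 != 1 -> ~~ two_zeros x y z ->
  twist w x y z = 0 -> twist w^-1 x y z != 0.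
Proof.
move=> w0 w1 nz T0; apply: contraNneq nz => T0'.
have z0: z = 0.
  have: (w ^+ 2 - 1) * z = w * (twist w^-1 x y z - twist w x y z).
    by rewrite /twist; field.
  rewrite T0 T0' subrr mulr0 => /eqP; rewrite mulf_eq0 subr_eq0 (negPf w1) /=.
  by move/eqP.
move: T0; rewrite /twist z0 mulr0 subr0 => /eqP; rewrite mulf_eq0 /two_zeros eqxx.
by case/orP=> ->; rewrite ?orbT.
Qed.

(** The substitution exchanges T_w and T_{w^-1} up to the factors -w and -1/w. Where one of them
    vanishes, the [nonzero_part] factors of the two values cancel; elsewhere [twist_norm]
    applies. *)
Lemma cocycle_vieta {K : fieldType} {w x y z : K} :
  w != 0 -> w ^+ 2 != 1 -> markoff w x y z -> ~~ two_zeros x y z ->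
  cocycle w x y z * cocycle w y x (x * y - z) = - w^-1.
Proof.
move=> w0 w1 E nz; rewrite /cocycle twist_vieta //.
have wV0: w^-1 != 0 by rewrite invr_eq0.
have := @twist_vieta K w^-1 x y z wV0; rewrite invrK => ->.
rewrite !mulf_eq0 oppr_eq0 (negPf w0) /=.
have := twist_norm w0 E; have := twist_neq0 w0 w1 nz.
have := nonzero_part_neq0 (y ^+ 2 - (w + w^-1 + 2)).
have := nonzero_part_neq0 (x ^+ 2 - (w + w^-1 + 2)).
set X := (x ^+ 2 - _); set Y := (y ^+ 2 - _).
move: (twist w x y z) (twist w^-1 x y z) => T T' X0 Y0 nT N.
case: (eqVneq T 0) => [/nT T0 | T0].
  by rewrite (negPf T0); field; rewrite ?oppr_eq0 w0 T0 ?X0 ?Y0.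
case: (eqVneq T' 0) => [T0' | T0'].
  by field; rewrite ?oppr_eq0 ?X0 ?Y0 w0 T0.
have: X * Y != 0 by rewrite -N mulf_neq0.
rewrite mulf_eq0 negb_or => /andP[X0' Y0'].
rewrite !nonzero_partE // in X0 Y0 *.
transitivity (- w^-1 * (X * Y) / (T * T')).
  by field; rewrite ?oppr_eq0 w0 T0 ?T0' ?X0' ?Y0'.
by rewrite N mulfK // mulf_neq0.
Qed.

Lemma markoff_rot {K : fieldType} {w x y z : K} :
  markoff w x y z -> markoff w y z x.
Proof. by rewrite /markoff => <-; ring. Qed.

Lemma markoffV {K : fieldType} {w x y z : K} :
  markoff w x y z -> markoff w^-1 x y z.
Proof. by rewrite /markoff invrK => ->; ring. Qed.

Lemma two_zeros_rot {K : fieldType} (x y z : K) :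
  two_zeros y z x = two_zeros x y z.
Proof. by rewrite /two_zeros orbA orbC. Qed.

Lemma cocycle_rot {K : fieldType} {w x y z : K} :
  w != 0 -> w ^+ 2 != 1 -> markoff w x y z -> ~~ two_zeros x y z ->
  cocycle w x y z * cocycle w y z x * cocycle w z x y = - w^-1.
Proof.
move=> w0 w1 Exyz nz; rewrite /cocycle.
have Eyzx := markoff_rot Exyz; have Ezxy := markoff_rot Eyzx.
have wV0: w^-1 != 0 by rewrite invr_eq0.
have nz1 : ~~ two_zeros y z x by rewrite two_zeros_rot.
have nz2 : ~~ two_zeros z x y by rewrite two_zeros_rot.
have My := twist_mul w0 Exyz; have Mz := twist_mul w0 Eyzx.
have Mx := twist_mul w0 Ezxy.
have My' := twist_mul wV0 (markoffV Exyz).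
have Mz' := twist_mul wV0 (markoffV Eyzx).
have Mx' := twist_mul wV0 (markoffV Ezxy).
rewrite !invrK [w^-1 + w]addrC in Mx' My' Mz'.
have Nzx := twist_norm w0 Ezxy.
have Tz' := twist_neq0 w0 w1 nz; have Tx' := twist_neq0 w0 w1 nz1.
have Ty' := twist_neq0 w0 w1 nz2.
have := nonzero_part_neq0 (x ^+ 2 - (w + w^-1 + 2)).
have := nonzero_part_neq0 (y ^+ 2 - (w + w^-1 + 2)).
have := nonzero_part_neq0 (z ^+ 2 - (w + w^-1 + 2)).
move: (x ^+ 2 - _) (y ^+ 2 - _) (z ^+ 2 - _) => X Y Z
  in Mx My Mz Mx' My' Mz' Nzx *.
move: (twist w x y z) (twist w^-1 x y z) => a a'
  in Mx My Mz Mx' My' Mz' Nzx Tz' *.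
move: (twist w y z x) (twist w^-1 y z x) => b b'
  in Mx My Mz Mx' My' Mz' Nzx Tx' *.
move: (twist w z x y) (twist w^-1 z x y) => c c'
  in Mx My Mz Mx' My' Mz' Nzx Ty' *.
move=> Z0 Y0 X0.
(* Cases by which of [a], [b], [c] vanish. All three cannot; with one or two zeros, a single
   [nonzero_part] survives cancellation and one of the six twist relations concludes. *)
case: eqVneq => [/Tz' a0' | a0]; case: eqVneq => [/Tx' b0' | b0];
  case: eqVneq => [c0 | c0]; try have c0' := Ty' c0.
- move: My'; rewrite c0 mulr0 => /eqP; rewrite mulf_eq0.
  by rewrite (negPf a0') (negPf b0').
- rewrite -[RHS](nonzero_part_prodr w0 _ My') ?mulf_neq0 //.
  by field; rewrite Y0 Z0 c0.
- rewrite -[RHS](nonzero_part_prodr w0 _ Mx') ?mulf_neq0 //.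
  by field; rewrite b0 X0 Y0.
- rewrite -[RHS](nonzero_part_prodl w0 _ Mz) ?mulf_neq0 //.
  by field; rewrite b0 c0 Y0.
- rewrite -[RHS](nonzero_part_prodr w0 _ Mz') ?mulf_neq0 //.
  by field; rewrite a0 X0 Z0.
- rewrite -[RHS](nonzero_part_prodl w0 _ Mx) ?mulf_neq0 //.
  by field; rewrite a0 c0 Z0.
- rewrite -[RHS](nonzero_part_prodl w0 _ My) ?mulf_neq0 //.
  by field; rewrite a0 b0 X0.
(* When no twist vanishes, the relations make [X], [Y], [Z] nonzero, and the product is the generic
   XYZ / (abc). *)
have: (c * a) * (a * b) * (b * c) != 0 by rewrite !mulf_neq0.
rewrite {1}Mx {1}My {1}Mz !mulf_eq0 !negb_or -!andbA.
case/and5P=> Nw0 X1 _ _ /and5P[Y1 _ _ Z1 _].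
rewrite !nonzero_partE // in X0 Y0 Z0 *.
transitivity (X * Y * Z / (a * b * c)); first by field; rewrite a0 b0 c0.
have -> : a * b * c = - w * (X * Y * Z).
  rewrite My; transitivity (- w * Y * (c * c')); first by ring.
  by rewrite Nzx; ring.
by field; rewrite Nw0 w0 X1 Y1 Z1.
Qed.

(** * Zero coordinates and stability of orbits *)

Definition zero_coords {K : fieldType} (P : 3.-tuple K) : nat :=
  \sum_i (tnth P i == 0%R).

Lemma zero_coordsE {K : fieldType} (P : 3.-tuple K) :
  (1 < zero_coords P)%N
    = two_zeros (tnth P (inord 0)) (tnth P (inord 1)) (tnth P (inord 2)).
Proof.
have -> : zero_coords P = ((tnth P (inord 0) == 0%R) + (tnth P (inord 1) == 0%R)
    + (tnth P (inord 2) == 0%R))%N.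
  rewrite /zero_coords !big_ord_recl big_ord0 addn0 addnA.
  by do !congr (_ + _)%N; congr (nat_of_bool (tnth P _ == 0%R));
    apply: val_inj; rewrite /= ?inordK.
by rewrite /two_zeros; do 3![case: (_ == 0)].
Qed.

(** If x or y is zero, the new coordinate is -z; otherwise two zeros occur neither before nor
    after. *)
Lemma two_zeros_vieta {K : fieldType} (x y z : K) :
  two_zeros x y (x * y - z) = two_zeros x y z.
Proof.
rewrite /two_zeros; case: (eqVneq x 0) => [->|_].
  by rewrite mul0r sub0r oppr_eq0.
by case: (eqVneq y 0) => [->|_]; rewrite ?mulr0 ?sub0r ?oppr_eq0 ?andbF.
Qed.

Lemma pm_act_perm {R : comNzRingType} (s : 'S_3) (P : 3.-tuple R) :
  pm_act (pm_perm s) P = [tuple tnth P (s i) | i < 3].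
Proof. by apply: eq_from_tnth => i; rewrite !tnth_mktuple mmapX mmap1U. Qed.

Lemma pm_act_vieta {R : comNzRingType} (P : 3.-tuple R) :
  pm_act pm_vieta P
    = [tuple tnth P (inord 0); tnth P (inord 1);
             tnth P (inord 0) * tnth P (inord 1) - tnth P (inord 2)].
Proof.
apply: eq_from_tnth; case=> [[|[|[|//]]] lti]; rewrite tnth_mktuple !(tnth_nth 0) /=.
- by rewrite mmapX mmap1U (tnth_nth 0).
- by rewrite mmapX mmap1U (tnth_nth 0).
by rewrite rmorphB rmorphM /= !mmapX !mmap1U !(tnth_nth 0).
Qed.

Lemma Gamma_zero_coords {K : fieldType} (f : polymap) (P : 3.-tuple K) :
  Gamma f -> (1 < zero_coords (pm_act f P))%N = (1 < zero_coords P)%N.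
Proof.
move=> Gf; elim: Gf P => {f}.
- by move=> P; rewrite pm_act_id.
- move=> s P; rewrite pm_act_perm /zero_coords; congr (1 < _)%N.
  rewrite [RHS](reindex_inj (@perm_inj _ s)).
  by apply: eq_bigr => i _; rewrite tnth_mktuple.
- move=> P; rewrite !zero_coordsE pm_act_vieta -[RHS]two_zeros_vieta.
  by rewrite !(tnth_nth 0) /= !inordK.
- by move=> f g _ IHf _ IHg P; rewrite pm_act_comp IHf IHg.
(* The claim for the inverse [g] is the one for [f] at [pm_act g P], which [f] sends back to [P]. *)
- by move=> f g _ IHf fg _ P; rewrite -[in RHS](pm_act_id P) -fg pm_act_comp IHf.
Qed.

Lemma Gamma_orbit_closed {F : finFieldType} (f : polymap) (P Q : 3.-tuple F) :
  Gamma f -> Q \in Gamma_orbit P -> pm_act f Q \in Gamma_orbit P.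
Proof.
move=> Gf; rewrite !inE => /asboolP[g Gg ->].
by apply/asboolP; exists (pm_comp f g); [apply: Gamma_comp | rewrite pm_act_comp].
Qed.

(** By finiteness, an injective self-map that preserves [O] permutes it. *)
Lemma big_stable {R : Type} {idx : R} {op : Monoid.com_law idx} {T : finType}
    (O : {set T}) (g : T -> T) (h : T -> R) :
  injective g -> {in O, forall x, g x \in O} ->
  \big[op/idx]_(x in O) h (g x) = \big[op/idx]_(x in O) h x.
Proof.
move=> g_inj gO; have gOE: g @: O = O.
  apply/eqP; rewrite eqEcard card_imset // leqnn andbT.
  by apply/subsetP => _ /imsetP[x xO ->]; apply: gO.
by rewrite -[in RHS]gOE big_imset //; apply: in2W.
Qed.

Lemma tuple3_inj {T : Type} (P Q : 3.-tuple T) :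
  tnth P (inord 0) = tnth Q (inord 0) -> tnth P (inord 1) = tnth Q (inord 1) ->
  tnth P (inord 2) = tnth Q (inord 2) -> P = Q.
Proof.
move=> E0 E1 E2; apply: eq_from_tnth => i; rewrite -(inord_val i).
by case: i => [[|[|[|//]]] lti].
Qed.

Lemma tnth3 {T : Type} (a b c : T) :
  (tnth [tuple a; b; c] (inord 0) = a) * (tnth [tuple a; b; c] (inord 1) = b)
  * (tnth [tuple a; b; c] (inord 2) = c).
Proof. by rewrite !(tnth_nth a) /= !inordK. Qed.

(** * The two substitutions, of orders 3 and 2 on points *)

Definition rotate {R : comNzRingType} (P : 3.-tuple R) : 3.-tuple R :=
  [tuple tnth P (inord 1); tnth P (inord 2); tnth P (inord 0)].

Definition swap_vieta {R : comNzRingType} (P : 3.-tuple R) : 3.-tuple R :=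
  let x := tnth P (inord 0) in let y := tnth P (inord 1) in
  [tuple y; x; x * y - tnth P (inord 2)].

(** Adding 1 in ['I_3], that is modulo 3, is the cyclic shift; [addrI] gives its injectivity. *)
Lemma rotateE {R : comNzRingType} (P : 3.-tuple R) :
  rotate P = pm_act (pm_perm (perm (addrI (1 : 'I_3)))) P.
Proof.
rewrite pm_act_perm; apply: eq_from_tnth.
case=> [[|[|[|//]]] lti]; rewrite tnth_mktuple permE (tnth_nth 0) /=;
  by congr (tnth P); apply: val_inj; rewrite /= inordK.
Qed.

Lemma swap_vietaE {R : comNzRingType} (P : 3.-tuple R) :
  swap_vieta P
    = pm_act (pm_comp (pm_perm (tperm (inord 0) (inord 1))) pm_vieta) P.
Proof.
rewrite pm_act_comp pm_act_perm pm_act_vieta.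
apply: tuple3_inj; rewrite tnth3 tnth_mktuple.
- by rewrite tpermL tnth3.
- by rewrite tpermR tnth3.
by rewrite tpermD ?tnth3 // -val_eqE /= !inordK.
Qed.

Lemma rotate_inj {R : comNzRingType} : injective (@rotate R).
Proof.
move=> P Q /(congr1 val)[E1 E2 E0].
exact: tuple3_inj.
Qed.

Lemma swap_vieta_inj {R : comNzRingType} : injective (@swap_vieta R).
Proof.
move=> P Q /(congr1 val)[E1 E0]; rewrite E0 E1 => /addrI /oppr_inj E2.
exact: tuple3_inj.
Qed.

(** * The order of the parameter against the orbit size *)

Lemma Gamma_orbit_expr {F K : finFieldType} (iota : {rmorphism F -> K})
    {w : K} {t : F} {P : 3.-tuple F} :
  w != 0 -> w ^+ 2 != 1 -> iota t = w + w^-1 -> on_surface t P ->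
  (zero_coords P < 2)%N -> w ^+ (2 * #|Gamma_orbit P|) = 1.
Proof.
move=> w0 w1 tE Pt Pz; set O := Gamma_orbit P.
pose x i (Q : 3.-tuple F) := iota (tnth Q (inord i)).
pose h Q := cocycle w (x 0%N Q) (x 1%N Q) (x 2%N Q).
(* Both hypotheses of the product formulas hold along the whole orbit. *)
have OP Q : Q \in O -> markoff w (x 0%N Q) (x 1%N Q) (x 2%N Q) /\
    ~~ two_zeros (x 0%N Q) (x 1%N Q) (x 2%N Q).
  rewrite inE => /asboolP[f Gf ->]; set R := pm_act f P.
  have: on_surface t R by rewrite Gamma_on_surface.
  have: ~~ (1 < zero_coords R)%N by rewrite Gamma_zero_coords // -leqNgt.
  rewrite zero_coordsE /two_zeros /x !fmorph_eq0 => -> p; split=> //.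
  rewrite /markoff -tE -[2](rmorph_nat iota) -rmorphD -(eqP p).
  by rewrite rmorphB !rmorphD !rmorphXn !rmorphM.
pose H := \prod_(Q in O) h Q.
have Hrot : H = \prod_(Q in O) h (rotate Q).
  rewrite big_stable //; first exact: rotate_inj.
  by move=> Q QO; rewrite rotateE; apply: Gamma_orbit_closed => //; constructor.
have Hrot2 : H = \prod_(Q in O) h (rotate (rotate Q)).
  rewrite big_stable //; first by move=> Q Q' /rotate_inj /rotate_inj.
  by move=> Q QO; rewrite !rotateE;
    do 2![apply: Gamma_orbit_closed; first by constructor].
have Hsv : H = \prod_(Q in O) h (swap_vieta Q).
  rewrite big_stable //; first exact: swap_vieta_inj.
  move=> Q QO; rewrite swap_vietaE; apply: Gamma_orbit_closed => //.
  by apply: Gamma_comp; constructor.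
have H2 : H ^+ 2 = (- w^-1) ^+ #|O|.
  rewrite expr2 {2}Hsv -big_split -prodr_const; apply: eq_bigr => Q /OP[m z].
  by rewrite /h /x !tnth3 rmorphB rmorphM; apply: cocycle_vieta.
have H3 : H ^+ 3 = (- w^-1) ^+ #|O|.
  rewrite exprS expr2 {2}Hrot {2}Hrot2 mulrA -!big_split -prodr_const.
  apply: eq_bigr => Q /OP[m z]; rewrite /h /x !tnth3.
  exact: cocycle_rot.
have: H ^+ 2 != 0 by rewrite H2 expf_neq0 // oppr_eq0 invr_eq0.
move=> Hn0; have H1 : H = 1.
  by apply: (mulIf Hn0); rewrite -exprS H3 H2 mul1r.
(* Squaring removes the sign (-1)^N. *)
move: H2; rewrite H1 expr1n => /(congr1 (fun a => a ^+ 2)).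
rewrite expr1n -exprM mulnC exprM sqrrN exprVn exprVn -exprM => /(congr1 GRing.inv).
by rewrite invr1 invrK.
Qed.

(** * The order of SL_2 *)

(** The matrices diag(c, 1) form a section of the determinant, so GL_2 is in bijection with the
    product of the unit group and SL_2. *)
Lemma card_SL2 (F : finFieldType) : #|SL2 F| = (#|F| ^ 3 - #|F|)%N.
Proof.
have F_gt1 := finNzRing_gt1 F.
pose D (c : F) : 'M[F]_2 := diag_mx (\row_j (if j == 0 then c else 1)).
have detD c : \det (D c) = c.
  by rewrite det_diag !big_ord_recl big_ord0 !mxE /= !mulr1.
have DM c d : D c *m D d = D (c * d).
  rewrite mulmx_diag; congr diag_mx; apply/rowP => j; rewrite !mxE.
  by case: ifP => // _; rewrite mulr1.
have D1 : D 1 = 1%:M.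
  by rewrite -diag_const_mx; congr diag_mx; apply/rowP => j; rewrite !mxE if_same.
pose f (u : {unit F} * 'M[F]_2) := D (val u.1) *m u.2.
have f_inj : {in setX setT (SL2 F) &, injective f}.
  move=> [u M] [v N] /setXP[_]; rewrite inE => /eqP M1 /setXP[_].
  rewrite inE => /eqP N1 fE.
  have uv : u = v.
    move/(congr1 determinant): fE.
    by rewrite !det_mulmx !detD M1 N1 !mulr1 => /val_inj.
  move: fE; rewrite /f /= uv => /(congr1 (mulmx (D (val v)^-1))).
  by rewrite !mulmxA DM mulVr ?(valP v) // D1 !mul1mx => ->.
have fE : f @: setX setT (SL2 F) = [set M : 'M[F]_2 | M \in unitmx].
  apply/setP => M; rewrite inE unitmxE; apply/imsetP/idP.
    case=> -[u N] /setXP[_]; rewrite inE => /eqP N1 ->.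
    by rewrite det_mulmx detD N1 mulr1 (valP u).
  move=> M1; exists (FinRing.unit F M1, D (\det M)^-1 *m M); last first.
    by rewrite /f /= mulmxA DM mulrV // D1 mul1mx.
  by apply/setXP; rewrite !inE det_mulmx detD mulVr.
have GLE : #|'GL_2[F]%g| = #|[set M : 'M[F]_2 | M \in unitmx]|.
  rewrite -(card_imset _ val_inj); apply: eq_card => M; rewrite inE.
  apply/imsetP/idP => [[u _ ->] | M1]; first exact: (valP u).
  by exists (FinRing.unit _ M1).
have := card_GL_2 F; rewrite GLE -fE card_in_imset // cardsX cardsT.
have -> : #|{: {unit F}}| = #|F|.-1 by rewrite -card_finField_unit cardsT.
(* With [#|F|] written [n.+2], the factor [n.+1] to cancel is the number of units. *)
move: F_gt1; case: #|F| => [//|[//|n]] _ /= E.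
have: (n.+1 * #|SL2 F| == n.+1 * (n.+2 ^ 3 - n.+2))%N.
  by rewrite E mulnBr; apply/eqP; lia.
by rewrite eqn_pmul2l // => /eqP.
Qed.

(** * Uniqueness and existence of the parameter *)

(** Clearing denominators factors the equation as (b - a)(ab - 1) = 0. *)
Lemma add_inv_eq {K : fieldType} (a b : K) :
  a != 0 -> b != 0 -> a + a^-1 = b + b^-1 -> b = a \/ b = a^-1.
Proof.
move=> a0 b0 E; have: (b - a) * (a * b - 1) = a * b * ((b + b^-1) - (a + a^-1)).
  by field; rewrite a0 b0.
rewrite E subrr mulr0 => /eqP; rewrite mulf_eq0 !subr_eq0.
case/orP=> /eqP; [by left | move=> ab; right].
by apply: (mulfI a0); rewrite ab divff.
Qed.

(** This makes the [#|F|]-th power map additive on [K]. *)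
Lemma finField_card_pchar (F : finFieldType) (K : fieldExtType F) :
  [pchar K].-nat #|F|.
Proof.
have [p p_pr pF] := finPcharP F.
rewrite (eq_pnat _ (pchar_lalg K)) (eq_pnat _ (pcharf_eq pF)).
by have /abelem_pgroup := fin_ring_pchar_abelem pF; rewrite /pgroup cardsT.
Qed.

Lemma quadratic_root {F K : fieldType} (f : {rmorphism F -> K}) (t : F) (a : K) :
  root (map_poly f ('X^2 - t *: 'X + 1)) a -> a != 0 /\ f t = a + a^-1.
Proof.
rewrite /root rmorphD rmorphB /= map_polyXn map_polyZ /= map_polyX rmorph1.
rewrite !hornerE => pa.
have a0 : a != 0.
  by apply: contraTneq pa => ->; rewrite expr0n mulr0 subr0 add0r oner_eq0.
split=> //; apply: (mulIf a0); rewrite mulrDl mulVf // -expr2.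
by apply/eqP; rewrite eq_sym -subr_eq0 addrAC.
Qed.

(** In a splitting field [K], the polynomial X^2 - tX + 1 divides X^(q^2) - X. This divisibility
    descends to [F] and passes to [L], where X^(q^2) - X splits. *)
Lemma exists_parameter {q : nat} {F L : finFieldType}
    (iota : {rmorphism F -> L}) (t : F) :
  #|F| = q -> #|L| = (q ^ 2)%N -> t != 2 -> t != - 2 ->
  exists2 w : L, w != 0 & iota t = w + w^-1.
Proof.
move=> cardF cardL t2 tm2.
pose p : {poly F} := 'X^2 - t *: 'X + 1.
have p_size : size p = 3.
  by rewrite /p -addrA size_polyDl size_polyXn // ltnS (leq_trans (size_polyD _ _)) //
    geq_max size_polyN size_poly1 (leq_trans (size_scale_leq _ _)) ?size_polyX.
have p0 : p != 0 by rewrite -size_poly_eq0 p_size.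
have [K [rs rsP _]] := FinSplittingFieldFor p0.
have [a]: exists a, root (map_poly (in_alg K) p) a.
  case: rs rsP => [|a rs] rsP.
    by move/eqp_size: rsP; rewrite big_nil size_map_poly p_size size_poly1.
  by exists a; rewrite (eqp_root rsP) big_cons rootM root_XsubC eqxx.
case/quadratic_root=> a0 tE; rewrite /= in tE.
(* The q-Frobenius permutes the roots a and a^-1 of p. *)
have aq : a ^+ q ^+ q = a.
  have E : a + a^-1 = a ^+ q + (a ^+ q)^-1.
    rewrite -exprVn -exprDn_pchar -?tE; last by rewrite -cardF finField_card_pchar.
    by rewrite exprZn expr1n -cardF expf_card.
  have [E' | E'] := add_inv_eq _ _ a0 (expf_neq0 q a0) E; first by rewrite !E'.
  by rewrite E' exprVn E' invrK.
(* A double root would be 1 or -1, forcing t = 2 or t = -2. Distinctness lets the product of both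
   linear factors divide X^(q^2) - X. *)
have aV : a != a^-1.
  apply/eqP => E; have: a ^+ 2 == 1 by rewrite expr2 {2}E divff.
  have t_inj b : in_alg K b = a + a^-1 -> t = b.
    by rewrite -tE => /esym; apply: (fmorph_inj (in_alg K)).
  rewrite sqrf_eq1 => /orP[] /eqP a1; rewrite -E a1 in t_inj.
    by case/eqP: t2; apply: t_inj; rewrite rmorph_nat.
  by case/eqP: tm2; apply: t_inj; rewrite rmorphN rmorph_nat -opprD.
have pdvd : p %| 'X^(q ^ 2) - 'X.
  rewrite -(dvdp_map (in_alg K)) rmorphB /= map_polyXn map_polyX.
  have -> : (map_poly (in_alg K) p) = \prod_(z <- [:: a; a^-1]) ('X - z%:P).
    rewrite /p rmorphD rmorphB /= map_polyXn map_polyZ /= map_polyX rmorph1 tE.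
    rewrite !big_cons big_nil mulr1 -mul_polyC polyCD.
    have : a%:P * a^-1%:P = 1 :> {poly K} by rewrite -polyCM divff.
    by move: a%:P a^-1%:P => u v uv; ring: uv.
  apply: uniq_roots_dvdp; last by rewrite uniq_rootsE /= inE aV.
  rewrite /= andbT /root !hornerE /= -mulnn !exprM exprVn exprVn aq.
  by rewrite !subrr eqxx.
(* A divisor of the product of all X - x is, up to a constant, a subproduct; its degree excludes the
   empty one. *)
have /dvdp_prod_XsubC[m] : map_poly iota p %| \prod_(x : L) ('X - x%:P).
  rewrite -finField_genPoly cardL.
  have <- : map_poly iota ('X^(q ^ 2) - 'X) = 'X^(q ^ 2) - 'X.
    by rewrite rmorphB /= map_polyXn map_polyX.
  by rewrite dvdp_map.
case: (mask m _) => [|w s] wP.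
  by move/eqp_size: wP; rewrite big_nil size_map_poly p_size size_poly1.
have: root (map_poly iota p) w.
  by rewrite (eqp_root wP) big_cons rootM root_XsubC eqxx.
by case/quadratic_root; exists w.
Qed.

(** * The parameter and the divisibility of orbit sizes *)

Theorem theorem1p2p7 (q : nat) (F L : finFieldType)
    (iota : {rmorphism F -> L})
    (hq : (3 <= q)%N) (cardF : #|F| = q) (cardL : #|L| = (q ^ 2)%N)
    (t : F) (ht2 : t != 2) (htm2 : t != - 2) :
  (exists w : {unit L}, is_parameter iota t w) /\
  (forall w w' : {unit L}, is_parameter iota t w -> is_parameter iota t w' ->
     [set w; w^-1]%g = [set w'; w'^-1]%g) /\
  (forall w : {unit L}, is_parameter iota t w ->
   forall A B C : F, on_surface t [tuple A; B; C] ->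
   (2 <= count (fun a : F => a != 0%R) [:: A; B; C])%N ->
   forall l : nat, prime l -> odd l ->
   let r := logn l #[w]%g in
   exists s : nat,
     [/\ logn l #|SL2 F| = logn l (q ^ 3 - q),
         logn l (q ^ 3 - q) = (r + s)%N
       & (l ^ maxn (r - s) 0 %| #|Gamma_orbit [tuple A; B; C]|)%N]).
Proof.
have unit_neq0 (w : {unit L}) : val w != 0 by rewrite -unitfE (valP w).
split; [|split].
- have [w w0 tE] := exists_parameter iota _ cardF cardL ht2 htm2.
  have wU : w \is a GRing.unit by rewrite unitfE.
  exists (FinRing.unit L wU); split=> //=.
    apply: contraNneq ht2 => w1; apply/eqP/(fmorph_inj iota).
    by rewrite tE w1 invr1 rmorph_nat.
  apply: contraNneq htm2 => w1; apply/eqP/(fmorph_inj iota).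
  by rewrite tE w1 invrN1 rmorphN rmorph_nat -opprD.
- move=> w w' [_ _ tw] [_ _ tw'].
  have [E | E] := add_inv_eq _ _ (unit_neq0 w) (unit_neq0 w') (etrans (esym tw) tw').
    by rewrite (val_inj E).
  have -> : w' = w^-1%g by apply: val_inj; rewrite E FinRing.val_unitV.
  by rewrite invgK setUC.
move=> w [w1 wN1 tw] A B C surf nz l l_pr l_odd r.
(* The order of w divides that of the unit group of [L], namely q^2 - 1; hence [s] can be taken as
   the difference of valuations. *)
have order_dvd : (#[w]%g %| q ^ 3 - q)%N.
  have -> : (q ^ 3 - q = q * (q ^ 2).-1)%N.
    by rewrite -subn1 mulnBr muln1 -expnS.
  by rewrite dvdn_mull // -cardL -card_finField_unit order_dvdG ?inE.
have r_le : (r <= logn l (q ^ 3 - q))%N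
  by apply: dvdn_leq_log; rewrite // subn_gt0 -{1}(expn1 q) ltn_exp2l // ltnW.
exists (logn l (q ^ 3 - q) - r)%N; split; first by rewrite card_SL2 cardF.
  by rewrite subnKC.
(* Natural subtraction already truncates at 0; it suffices that [l ^ r] divides the orbit size. *)
rewrite maxn0; apply: dvdn_trans (dvdn_exp2l l (leq_subr _ r)) _.
have w2 : val w ^+ 2 != 1 by rewrite sqrf_eq1 negb_or w1.
have zc : (zero_coords [tuple A; B; C] < 2)%N.
  rewrite ltnNge zero_coordsE /two_zeros !tnth3; move: nz => /=.
  by do 3![case: (_ == 0)].
have := Gamma_orbit_expr iota (unit_neq0 w) w2 tw surf zc.
rewrite -FinRing.val_unitX -FinRing.val_unit1 => /val_inj /eqP.
(* Here [l ^ r] divides the order of w, hence 2N, and is coprime to 2 as [l] is odd. *)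
rewrite -order_dvdn => /(dvdn_trans (pfactor_dvdnn l _)).
by rewrite Gauss_dvdr // coprimeXl // coprimen2.
Qed.
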